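(* Let $\mathbb K$ be a non-Archimedean valued field with nontrivial valuation, let $X$ be a separable $F$-space over $\mathbb K$ and let $T:X\to X$ be a continuous linear operator. If $T$ satisfies the Hypercyclic Criterion, then $T$ is hypercyclic.
   Context: A non-Archimedean valued field is a commutative field $\mathbb K$ with a map $|\cdot|:\mathbb K\to[0,+\infty)$ such that $|\lambda|=0$ iff $\lambda=0$, $|\lambda\mu|=|\lambda||\mu|$, and $|\lambda+\mu|\le\max\{|\lambda|,|\mu|\}$; the valuation is always assumed nontrivial. An $F$-space is a topological vector space over $\mathbb K$ which is metrizable and complete. A continuous linear operator $T$ on a topological vector space $X$ is hypercyclic if there exists $\mathbf x\in X$ whose orbit $\{T^n(\mathbf x): n\in\mathbb Z,\ n\ge 0\}$ is dense in $X$. $T$ satisfies the Hypercyclic Criterion if there exist a (strictly) increasing sequence of nonnegative integers $(n_k)$, two dense sets $\mathcal D_1,\mathcal D_2\subset X$ and a sequence of maps $S_{n_k}:\mathcal D_2\to X$ (not assumed linear or continuous) such that, as $k\to\infty$: (1) $T^{n_k}(\mathbf x)\to\mathbf 0$ for any $\mathbf x\in\mathcal D_1$; (2) $S_{n_k}(\mathbf y)\to\mathbf 0$ for any $\mathbf y\in\mathcal D_2$; (3) $T^{n_k}S_{n_k}(\mathbf y)\to\mathbf y$ for any $\mathbf y\in\mathcal D_2$. *)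

(* Defs.v *)
From HB Require Import structures.
From mathcomp Require Import all_boot all_order all_algebra.
From mathcomp Require Import all_classical all_reals topology.
(* The files on normed spaces are deliberately not loaded: they declare joins of
   topological and algebraic structures over an ordered scalar ring, which
   prevent declaring the same joins over a non-Archimedean field. *)

Set Implicit Arguments.
Unset Strict Implicit.
Unset Printing Implicit Defensive.

Import Order.TTheory GRing.Theory Num.Theory.

Local Open Scope classical_set_scope.
Local Open Scope ring_scope.

HB.structure Definition UniformSpaceZmodule := {M of Uniform M & GRing.Zmodule M}.

(* The last axiom says that the metric, hence the topology, of K is the one
   given by its valuation. *)
HB.mixin Record Field_isNonArchimedean (R : realType) K
    & GRing.Field K & Metric R K := {
  valuation : K -> R ;
  valuation_ge0 : forall x, 0 <= valuation x ;
  valuation_eq0 : forall x, valuation x = 0 <-> x = 0 ;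
  valuationM : forall x y : K,
    valuation (x * y) = valuation x * valuation y ;
  valuationD_max : forall x y : K,
    valuation (x + y) <= Num.max (valuation x) (valuation y) ;
  valuation_nontrivial : exists2 x : K, x != 0 & valuation x != 1 ;
  mdist_valuation : forall x y : K, mdist x y = valuation (x - y)
}.

#[short(type="nonArchFieldType")]
HB.structure Definition NonArchField (R : realType) :=
  {K of GRing.Field K & Metric R K & Field_isNonArchimedean R K}.

(* A topological abelian group carries exactly one uniformity that induces its
   topology and makes subtraction uniformly continuous: U is an entourage iff
   it contains {(x, y) | y - x \in V} for some neighborhood V of 0. Bundling it
   thus costs no generality, and makes completeness of the uniform space the
   usual completeness of a topological vector space. *)
HB.mixin Record Lmodule_isValuedTvs (R : realType) (K : nonArchFieldType R) X
    & Uniform X & GRing.Lmodule K X := {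
  sub_unif_continuous : unif_continuous (fun z : X * X => z.1 - z.2 : X) ;
  scale_continuous : continuous (fun z : K * X => z.1 *: z.2 : X)
}.

#[short(type="valuedTvsType")]
HB.structure Definition ValuedTvs (R : realType) (K : nonArchFieldType R) :=
  {X of Uniform X & GRing.Lmodule K X & Lmodule_isValuedTvs R K X}.

Definition is_metric (R : realType) (X : Type) (d : X -> X -> R) :=
  [/\ forall x y, 0 <= d x y,
      forall x y, d x y = 0 <-> x = y,
      forall x y, d x y = d y x &
      forall x y z, d x z <= d x y + d y z].

Definition metrizable (R : realType) (X : topologicalType) :=
  exists2 d : X -> X -> R, is_metric d &
    forall (x : X) (A : set X),
      nbhs x A <-> exists2 e : R, 0 < e & [set y | d x y < e] `<=` A.

HB.mixin Record Topological_isMetrizable (R : realType) X & Topological X := {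
  metrizableP : metrizable R X
}.

#[short(type="fSpaceType")]
HB.structure Definition FSpace (R : realType) (K : nonArchFieldType R) :=
  {X of ValuedTvs R K X & Complete X & Topological_isMetrizable R X}.

Definition separable_space (X : topologicalType) :=
  exists2 D : set X, countable D & dense D.

Section hypercyclicity.
Context (R : realType) (K : nonArchFieldType R) (X : valuedTvsType K).
Implicit Type T : {linear X -> X}.

Definition orbit_of T (x : X) : set X := range (fun n : nat => iter n T x).

Definition hypercyclic T := exists x : X, dense (orbit_of T x).

(* [S k] stands for S_{n_k}; only its values on [D2] matter. *)
Definition hypercyclic_criterion T :=
  exists (n_ : nat -> nat) (D1 D2 : set X) (S : nat -> X -> X),
    [/\ {homo n_ : i j / (i < j)%N},
        dense D1 /\ dense D2,
        forall x, D1 x -> iter (n_ k) T x @[k --> \oo] --> (0 : X),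
        forall y, D2 y -> S k y @[k --> \oo] --> (0 : X) &
        forall y, D2 y -> iter (n_ k) T (S k y) @[k --> \oo] --> y].

End hypercyclicity.

(* Main.v *)
Require Import Defs.
From mathcomp Require Import all_boot all_order all_algebra.
From mathcomp Require Import all_classical all_reals topology.

(** The vector produced by the criterion is found by category, not built as a
    series. Two ideas meet.

    The criterion makes [T] topologically transitive
    ([hypercyclic_criterion_transitive]): for [x] in [D1] and [y] in [D2], the
    vector [x + S_{n_k} y] tends to [x], while its image under [T^{n_k}], which
    is [T^{n_k} x + T^{n_k} S_{n_k} y], tends to [0 + y]. So some iterate of [T]
    sends a point of any given nonempty open set into any other.

    Birkhoff's theorem ([birkhoff_transitivity]) turns transitivity into a dense
    orbit. With a countable basis of nonempty open sets [b n], the vectors whose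
    orbit meets [b n] form a set that is open, by continuity, and dense, by
    transitivity; a vector in all of these sets has a dense orbit, and Baire's
    theorem provides one.

    What takes some care is that completeness is a property of the uniformity,
    whereas metrizability is a property of the topology, by a metric that may
    be neither complete nor translation invariant. Baire's theorem is therefore
    proved for complete uniform spaces with a countable base of entourages
    ([baire_complete_uniform]), and such a base is obtained by translating
    a countable base of neighborhoods of [0]
    ([metrizable_countable_uniformity]). The metric is used a second time to
    get a countable basis of open sets out of separability
    ([separable_metrizable_second_countable]). *)

Set Implicit Arguments.
Unset Strict Implicit.
Unset Printing Implicit Defensive.

Import Order.TTheory GRing.Theory Num.Theory.

Local Open Scope classical_set_scope.
Local Open Scope ring_scope.

(** One step of the nested construction: the closure of the smaller open set
    [B] is what makes the limit point of the construction land in [A] and [U],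
    and the smallness of [B] with respect to [E] is what makes the construction
    converge. *)
Lemma baire_step (X : uniformType) (E : set (X * X)) (A U : set X) :
  entourage E -> open A -> A !=set0 -> open U -> dense U ->
  exists B : set X, [/\ open B, B !=set0, closure B `<=` A `&` U &
    forall x y, B x -> B y -> E (x, y)].
Proof.
move=> entE oA A0 oU dU.
have [x AUx] := dU _ A0 oA.
have nAU : nbhs x (A `&` U) by apply: open_nbhs_nbhs; split => //; exact: openI.
have [V nV VAU] := @uniform_regular X x _ nAU.
pose E' := split_ent E `&` (split_ent E)^-1%relation.
have entE' : entourage E' by apply: entourage_invI; exact: entourage_split_ent.
have nB : nbhs x (V `&` xsection E' x).
  by apply: filterI => //; exact: nbhs_entourage.
exists (V `&` xsection E' x)°; split.
- exact: open_interior.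
- by exists x; exact: nB.
- apply: subset_trans VAU; apply: closureS => y /interior_subset.
  by case.
- move=> y z /interior_subset[_ /xsectionP[_ /= yx]].
  move=> /interior_subset[_ /xsectionP[xz _]].
  exact: (entourage_split x).
Qed.

(** Nested open sets [A n], of which [A n.+1] is small of order [E n] and has
    its closure in both [A n] and [U n], generate a Cauchy filter; its limit
    lies in the closure of every [A n], hence in every [U n]. *)
Lemma baire_complete_uniform (X : completeType) (U : nat -> set X) :
  countable_uniformity X -> (forall n, open (U n)) -> (forall n, dense (U n)) ->
  dense (\bigcap_n U n).
Proof.
move=> /countable_uniformityP[E baseE entE] oU dU O O0 oO.
have /choice[f fP] : forall p : nat * set X, exists B : set X,
    open p.2 -> p.2 !=set0 ->
    [/\ open B, B !=set0, closure B `<=` p.2 `&` U p.1 &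
        forall x y, B x -> B y -> E p.1 (x, y)].
  move=> [n A] /=; have [oA|] := pselect (open A); last by exists setT.
  have [A0|] := pselect (A !=set0); last by exists setT.
  by have [B BP] := baire_step (entE n) oA A0 (oU n) (dU n); exists B.
pose A := fix A n := if n is m.+1 then f (m, A m) else O.
have A_open n : open (A n) /\ A n !=set0.
  by elim: n => [|n [oAn An0]] //=; have [] := fP (n, A n) oAn An0.
have A_step n : [/\ open (A n.+1), A n.+1 !=set0,
    closure (A n.+1) `<=` A n `&` U n &
    forall x y, A n.+1 x -> A n.+1 y -> E n (x, y)].
  by have [oAn An0] := A_open n; have := fP (n, A n) oAn An0.
have A_decr n m : (n <= m)%N -> A m `<=` A n.
  elim: m => [|m IH]; first by rewrite leqn0 => /eqP->.
  rewrite leq_eqVlt => /orP[/eqP->//|/IH] /(subset_trans _); apply.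
  have [_ _ + _] := A_step m => /(subset_trans (@subset_closure _ _)).
  by move=> AU x /AU[].
pose F := filter_from setT A.
have FF : ProperFilter F.
  apply: filter_from_proper; last by move=> n _; have [] := A_open n.
  apply: filter_from_filter; first by exists 0%N.
  move=> i j _ _; exists (maxn i j) => // x Ax; split; apply: A_decr Ax.
  - exact: leq_maxl.
  - exact: leq_maxr.
have FA n : F (A n) by exists n.
have cF : cauchy F.
  move=> P /baseE[n EP]; exists (A n.+1, A n.+1).
    by split; exact: (FA n.+1).
  move=> -[x y] [/= Ax Ay].
  by apply: EP; have [_ _ _] := A_step n; exact.
have {}cF := cauchy_cvg F cF.
have limA n : closure (A n) (lim F).
  by move=> B /cF FB; apply: (@filter_ex _ F); apply: filterI.
exists (lim F); split.
  by have [_ _ + _] := A_step 0%N => /(_ _ (limA 1%N))[].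
by move=> n _; have [_ _ + _] := A_step n => /(_ _ (limA n.+1))[].
Qed.

Definition topologically_transitive (X : topologicalType) (f : X -> X) :=
  forall U V : set X, open U -> U !=set0 -> open V -> V !=set0 ->
    exists n : nat, exists2 x, U x & V (iter n f x).

Lemma iter_continuous (X : topologicalType) (f : X -> X) n :
  continuous f -> continuous (iter n f).
Proof.
move=> cf; elim: n => [|n IH] x; first exact: cvg_id.
exact: (@continuous_comp _ _ _ (iter n f) f x (IH x) (cf _)).
Qed.

(** The points whose orbit meets a given basic open set form a dense open set,
    and a point in all of these sets has a dense orbit. *)
Lemma birkhoff_transitivity (X : completeType) (f : X -> X) :
  countable_uniformity X -> @second_countable X -> continuous f ->
  topologically_transitive f -> exists x, dense (range (fun n => iter n f x)).
Proof.
move=> cuX [B cB [oB baseB]] cf tf.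
(* A basis cannot be empty since the space is pointed, so it is enumerated by
   some [b]. *)
have [B0|/unsquash b] := pfcard_geP cB.
  have [A [+ _] _] := baseB point setT filterT.
  by rewrite B0.
have bB n : B (b n) by exact: funS.
(* The premise makes [U n] the whole space when [b n] is empty, which a basis
   allows. *)
pose U n := [set x | b n !=set0 -> exists k, b n (iter k f x)].
have oU n : open (U n).
  have [bn0|bn0] := pselect (b n !=set0).
    have -> : U n = \bigcup_k (iter k f @^-1` b n).
      by apply/seteqP; split=> [x /(_ bn0)[k]|x [k _]]; exists k.
    apply: bigcup_open => k _; apply: open_comp; last exact/oB.
    by move=> x _; exact: iter_continuous.
  have -> : U n = setT by apply/seteqP; split=> // x _ /bn0.
  exact: openT.
have dU n : dense (U n).
  move=> O O0 oO; have [bn0|bn0] := pselect (b n !=set0).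
    have [k [x Ox bx]] := tf O (b n) oO O0 (oB _ (bB n)) bn0.
    by exists x; split=> // _; exists k.
  by have [x Ox] := O0; exists x; split=> // /bn0.
have [x [_ Ux]] := baire_complete_uniform cuX oU dU (ex_intro _ point I) openT.
exists x => O [y Oy] oO.
have [A [/= BA Ay] AO] := baseB y O (open_nbhs_nbhs (conj oO Oy)).
have [n _ bnA] : (b @` setT) A by exact: surj.
have [] := Ux n I; first by exists y; rewrite bnA.
move=> k; rewrite bnA => /AO Ok.
by exists (iter k f x); split=> //; exists k.
Qed.

Lemma separable_metrizable_second_countable (R : realType)
    (X : topologicalType) :
  separable_space X -> metrizable R X -> @second_countable X.
Proof.
move=> [D cD dD] [d [_ d0 dC dD3] nbhsd].
pose ball (x : X) (e : R) := [set y | d x y < e].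
have oball x e : open (ball x e).
  rewrite openE => y /= xye; apply/nbhsd.
  exists (e - d x y); first by rewrite subr_gt0.
  by move=> z /=; rewrite ltrBrDl; apply: le_lt_trans.
exists [set ball p.1 p.2.+1%:R^-1 | p in D `*` [set: nat]].
  by apply: sub_countable (card_image_le _ _) (countableX cD _).
split; first by move=> _ [p _ <-]; exact: oball.
move=> x O /nbhsd[e e0 xeO].
have e20 : 0 < e / 2 by rewrite divr_gt0.
have [k] := ltr_add_invr e20; rewrite add0r => ke.
have [y [xy Dy]] : ball x k.+1%:R^-1 `&` D !=set0.
  by apply: dD => //; exists x; rewrite /ball /= (d0 x x).2 // invr_gt0 ltr0n.
exists (ball y k.+1%:R^-1).
  by split; [exists (y, k)|rewrite /ball /= dC].
move=> z yz; apply: xeO => /=.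
apply: le_lt_trans (dD3 x y z) _; rewrite (splitr e).
by apply: ltrD; apply: lt_trans ke.
Qed.

Section topological_vector_space.
Context (R : realType) (K : nonArchFieldType R) (X : valuedTvsType K).

(** Uniform continuity of subtraction, with the entourage of the product
    replaced by a single entourage of [X] that serves for both arguments. *)
Lemma sub_entourage (E : set (X * X)) : entourage E ->
  exists2 V, entourage V & forall x x' y y' : X,
    V (x, x') -> V (y, y') -> E (x - y, x' - y').
Proof.
move=> /(sub_unif_continuous (s := X)) [[V W] /= [entV entW] VWE].
exists (V `&` W); first exact: filterI.
move=> x x' y y' [Vx _] [_ Wy].
have [[[a b] [a1 b1]] /= Eab [<- <- <- <-]] :=
  VWE ((x, x'), (y, y')) (conj Vx Wy).
exact: Eab.
Qed.

(** This lemma and the next one say that the uniformity of [X] is the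
    translation-invariant one. Here [(x, y)] close gives [(x - x, y - x)]
    close, that is, [y - x] close to [0]. *)
Lemma nbhs0_entourage (A : set X) :
  nbhs 0 A -> entourage [set p : X * X | A (p.2 - p.1)].
Proof.
rewrite -nbhs_entourageE => -[E entE EA].
have [V entV VE] := sub_entourage entE.
apply: filterS (entV) => -[x y] Vxy; apply: EA; apply/xsectionP => /=.
by have := VE _ _ _ _ Vxy (entourage_refl x entV); rewrite subrr.
Qed.

(** Conversely, [y - x] close to [0] gives [0 - (- x)] close to
    [(y - x) - (- x)], that is, [x] close to [y]. *)
Lemma entourage_nbhs0 (E : set (X * X)) : entourage E ->
  exists2 A, nbhs (0 : X) A & forall x y, A (y - x) -> E (x, y).
Proof.
move=> entE; have [V entV VE] := sub_entourage entE.
exists (xsection V 0); first exact: nbhs_entourage.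
move=> x y /xsectionP Vxy.
have := VE 0 (y - x) (- x) (- x) Vxy (entourage_refl _ entV).
by rewrite sub0r opprK subrK.
Qed.

(** The entourages come from translating the balls centered at [0]; the sets of
    pairs at distance less than [e] would not do, as the metric need not be
    uniformly equivalent to the uniformity of [X]. *)
Lemma metrizable_countable_uniformity :
  metrizable R X -> countable_uniformity X.
Proof.
move=> [d _ nbhsd]; apply/countable_uniformityP.
exists (fun n => [set p : X * X | d 0 (p.2 - p.1) < n.+1%:R^-1]).
- move=> E /entourage_nbhs0[A /nbhsd[e e0 deA] AE].
  have [n] := ltr_add_invr e0; rewrite add0r => ne.
  by exists n => -[x y] /= dxy; apply/AE/deA => /=; exact: lt_trans ne.
- move=> n; apply: (@nbhs0_entourage [set y | d 0 y < n.+1%:R^-1]).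
  by apply/nbhsd; exists n.+1%:R^-1; rewrite ?invr_gt0 ?ltr0n.
Qed.

Lemma cvg_add (I : Type) (F : set_system I) (FF : Filter F) (u v : I -> X)
    (a b : X) :
  u @ F --> a -> v @ F --> b -> (fun k => u k + v k) @ F --> a + b.
Proof.
move=> ua vb A; rewrite -nbhs_entourageE => -[E entE EA].
have [V entV VE] := sub_entourage entE.
have [W entW WV] := sub_entourage entV.
have nu : \forall k \near F, V (a, u k).
  have : \forall k \near F, xsection V a (u k).
    by apply: ua; exact: nbhs_entourage.
  by apply: filterS => k /xsectionP.
have nv : \forall k \near F, W (b, v k).
  have : \forall k \near F, xsection W b (v k).
    by apply: vb; exact: nbhs_entourage.
  by apply: filterS => k /xsectionP.
apply: filterS (filterI nu nv) => k [Vk Wk]; apply/EA/xsectionP.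
(* The sum is written as the iterated difference [a - (0 - b)]. *)
rewrite -[b]opprK -[v k]opprK -(sub0r b) -(sub0r (v k)).
by apply/VE/WV => //; exact: entourage_refl.
Qed.

Lemma iter_linearD (T : {linear X -> X}) n x y :
  iter n T (x + y) = iter n T x + iter n T y.
Proof. by elim: n => //= n ->; rewrite raddfD. Qed.

(** The witness sent from [U] to [V] is [x + S k y] for large [k]: a small
    perturbation of [x] that [T^{n_k}] moves close to [y]. *)
Lemma hypercyclic_criterion_transitive (T : {linear X -> X}) :
  hypercyclic_criterion T -> topologically_transitive T.
Proof.
move=> [n_ [D1 [D2 [S [_ [dD1 dD2] TD1 SD2 TSD2]]]]] U V oU U0 oV V0.
have [x [Ux D1x]] := dD1 U U0 oU.
have [y [Vy D2y]] := dD2 V V0 oV.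
have cvgx : x + S k y @[k --> \oo] --> x.
  by have := cvg_add _ (cvg_cst x) (SD2 _ D2y); rewrite addr0; apply.
have cvgy : iter (n_ k) T (x + S k y) @[k --> \oo] --> y.
  under eq_fun do rewrite iter_linearD.
  by have := cvg_add _ (TD1 _ D1x) (TSD2 _ D2y); rewrite add0r; apply.
have nU : \forall k \near \oo, U (x + S k y).
  by apply: cvgx; exact: open_nbhs_nbhs.
have nV : \forall k \near \oo, V (iter (n_ k) T (x + S k y)).
  by apply: cvgy; exact: open_nbhs_nbhs.
have [k [Uk Vk]] := filter_ex (filterI nU nV).
by exists (n_ k), (x + S k y).
Qed.

End topological_vector_space.

Theorem theorem3p5 (R : realType) (K : nonArchFieldType R) (X : fSpaceType K)
    (T : {linear X -> X}) :
  separable_space X -> continuous T -> hypercyclic_criterion T -> hypercyclic T.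
Proof.
move=> sX cT hT.
apply: birkhoff_transitivity => //.
- exact/metrizable_countable_uniformity/metrizableP.
- exact: separable_metrizable_second_countable sX (@metrizableP R K X).
- exact: hypercyclic_criterion_transitive hT.
Qed.
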